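(* Let $R$ be any (associative unital) ring. (1) If an $R$-module is Gorenstein AC-flat, then it is a direct summand of a strongly Gorenstein AC-flat $R$-module. (2) If the ring $R$ is such that the class of Gorenstein AC-flat $R$-modules is closed under extensions, then every direct summand of a Gorenstein AC-flat $R$-module is Gorenstein AC-flat.
   Context: $R$-module means left $R$-module. $\mathrm{FP}_\infty$ is the class of modules having a resolution by finitely generated projective modules. A right $R$-module $A$ is absolutely clean if $\mathrm{Ext}^1_R(F,A)=0$ for all right $R$-modules $F\in\mathrm{FP}_\infty$. An $R$-module $M$ is Gorenstein AC-flat if there is an exact complex of flat modules $\mathbf F=\cdots\to F_1\to F_0\to F_{-1}\to\cdots$ such that $A\otimes_R\mathbf F$ is exact for every absolutely clean right $R$-module $A$ and $M$ is one of the cycles of $\mathbf F$. An $R$-module $M$ is strongly Gorenstein AC-flat if there is an exact complex of flat modules of the form $\mathbf F=\cdots\xrightarrow{d}F\xrightarrow{d}F\xrightarrow{d}F\xrightarrow{d}\cdots$ (all terms and all differentials the same) such that $A\otimes_R\mathbf F$ is exact for every absolutely clean right $R$-module $A$ and $M=\mathrm{Ker}(d\colon F\to F)$. *)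

(* Defs.v *)
From HB Require Import structures.
From mathcomp Require Import all_boot all_algebra.
From mathcomp Require Import boolp.
From mathcomp Require Import generic_quotient ring_quotient.
From mathcomp Require Import freeg.

Set Implicit Arguments.
Unset Strict Implicit.
Unset Printing Implicit Defensive.

Import GRing.Theory.
Local Open Scope ring_scope.
Local Open Scope quotient_scope.

(* Rings are pzRingType, so that the zero ring is not excluded.  A right      *)
(* R-module is a left module over the converse ring: for A : lmodType R^c,    *)
(* (r : R^c) *: a stands for a * r.                                           *)

Section Tensor.
Variables (R : pzRingType) (A : lmodType R^c) (M : lmodType R).

Definition free_pair : zmodType := {freeg (A * M)%type / int}.

Definition pair_gen (a : A) (m : M) : free_pair :=
  Freeg [:: (1 : int, (a, m))].

Inductive tensor_rel : free_pair -> Prop :=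
| tensor_rel0 : tensor_rel 0
| tensor_relB x y : tensor_rel x -> tensor_rel y -> tensor_rel (x - y)
| tensor_relDl a a' m :
    tensor_rel (pair_gen (a + a') m - (pair_gen a m + pair_gen a' m))
| tensor_relDr a m m' :
    tensor_rel (pair_gen a (m + m') - (pair_gen a m + pair_gen a m'))
| tensor_relZ a (r : R) m :
    tensor_rel (pair_gen ((r : R^c) *: a) m - pair_gen a (r *: m)).

Definition tensor_relb : {pred free_pair} := fun x => `[< tensor_rel x >].

Fact tensor_relb_zmod_closed : zmod_closed tensor_relb.
Proof.
split=> [|x y /asboolP rx /asboolP ry]; apply/asboolP.
  exact: tensor_rel0.
exact: tensor_relB.
Qed.
HB.instance Definition _ :=
  GRing.isZmodClosed.Build free_pair tensor_relb tensor_relb_zmod_closed.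

Definition tensor : zmodType := Quotient.quot tensor_relb.

Definition tens (a : A) (m : M) : tensor :=
  \pi_(Quotient.quot tensor_relb) (pair_gen a m).

End Tensor.

Section TensorMap.
Variables (R : pzRingType) (A B : lmodType R^c) (M N : lmodType R).
Variables (f : A -> B) (g : M -> N).

Definition free_pair_map (x : free_pair A M) : free_pair B N :=
  fglift (fun am : A * M =>
    Freeg [:: (1 : int, (f am.1, g am.2))] : {freeg (B * N)%type / int}) x.

(* The value does not depend on the representative when f and g are linear,   *)
(* see tensor_map_tens and tensor_mapB.                                       *)
Definition tensor_map (t : tensor A M) : tensor B N :=
  \pi_(Quotient.quot (@tensor_relb R B N)) (free_pair_map (repr t)).

End TensorMap.

Section TensorMapTheory.
Variables (R : pzRingType) (A B : lmodType R^c) (M N : lmodType R).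
Variables (f : {linear A -> B}) (g : {linear M -> N}).

Fact free_pair_mapB x y : free_pair_map f g (x - y) =
  free_pair_map f g x - free_pair_map f g y.
Proof. exact: lift_is_additive. Qed.

Fact free_pair_map_gen a m :
  free_pair_map f g (pair_gen a m) = pair_gen (f a) (g m).
Proof. by rewrite /free_pair_map liftU scale1r. Qed.

Fact free_pair_map_rel x :
  tensor_rel x -> tensor_rel (free_pair_map f g x).
Proof.
have map0 : free_pair_map f g 0 = 0.
  by rewrite -{1}(subrr 0) free_pair_mapB subrr.
have mapD u v : free_pair_map f g (u + v) =
    free_pair_map f g u + free_pair_map f g v.
  rewrite -{1}[v]opprK free_pair_mapB -[- v]sub0r free_pair_mapB map0.
  by rewrite sub0r opprK.
elim=> {x} [|x y _ IHx _ IHy|a a' m|a m m'|a r m].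
- by rewrite map0; exact: tensor_rel0.
- by rewrite free_pair_mapB; exact: tensor_relB.
- rewrite free_pair_mapB mapD !free_pair_map_gen linearD.
  exact: tensor_relDl.
- rewrite free_pair_mapB mapD !free_pair_map_gen linearD.
  exact: tensor_relDr.
- rewrite free_pair_mapB !free_pair_map_gen !linearZ_LR.
  exact: tensor_relZ.
Qed.

Fact tensor_map_pi (x : free_pair A M) :
  tensor_map f g (\pi_(Quotient.quot (@tensor_relb R A M)) x) =
  \pi_(Quotient.quot (@tensor_relb R B N)) (free_pair_map f g x).
Proof.
have /asboolP rel_x :
    repr (\pi_(Quotient.quot (@tensor_relb R A M)) x) - x
      \in @tensor_relb R A M by rewrite Quotient.idealrBE reprK.
apply/eqP; rewrite -Quotient.idealrBE -free_pair_mapB.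
exact/asboolP/free_pair_map_rel.
Qed.

Fact tensor_map_tens a m : tensor_map f g (tens a m) = tens (f a) (g m).
Proof. by rewrite tensor_map_pi free_pair_map_gen. Qed.

Fact tensor_mapB t u :
  tensor_map f g (t - u) = tensor_map f g t - tensor_map f g u.
Proof.
rewrite -[t]reprK -[u]reprK -raddfB !tensor_map_pi free_pair_mapB.
by rewrite raddfB.
Qed.

End TensorMapTheory.

Definition exact (U V : Type) (W : zmodType) (f : U -> V) (g : V -> W) : Prop :=
  forall y : V, g y = 0 <-> exists x : U, f x = y.

Definition surjective (U V : Type) (f : U -> V) : Prop :=
  forall y : V, exists x : U, f x = y.

Definition finitely_generated (R : pzRingType) (M : lmodType R) : Prop :=
  exists (n : nat) (g : 'I_n -> M),
    forall x : M, exists c : 'I_n -> R, x = \sum_(i < n) c i *: g i.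

Definition projective (R : pzRingType) (P : lmodType R) : Prop :=
  forall (U V : lmodType R) (p : {linear U -> V}) (f : {linear P -> V}),
    surjective p -> exists h : {linear P -> U}, forall x, p (h x) = f x.

(* ... -> P 1 -> P 0 -> M -> 0, with d n : P n.+1 -> P n and augmentation e   *)
Definition resolution (R : pzRingType) (M : lmodType R) (P : nat -> lmodType R)
    (d : forall n, {linear P n.+1 -> P n}) (e : {linear P 0%N -> M}) : Prop :=
  [/\ surjective e, exact (d 0%N) e & forall n, exact (d n.+1) (d n)].

Definition FP_infty (R : pzRingType) (M : lmodType R) : Prop :=
  exists (P : nat -> lmodType R) (d : forall n, {linear P n.+1 -> P n})
    (e : {linear P 0%N -> M}),
    (forall n, finitely_generated (P n) /\ projective (P n)) /\
    resolution d e.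

(* Ext^1_R(M, A) = H^1(Hom_R(P, A)) = 0 for the projective resolutions P of   *)
(* M: every 1-cocycle is a 1-coboundary.                                      *)
Definition Ext1_eq0 (R : pzRingType) (M A : lmodType R) : Prop :=
  forall (P : nat -> lmodType R) (d : forall n, {linear P n.+1 -> P n})
    (e : {linear P 0%N -> M}),
    (forall n, projective (P n)) -> resolution d e ->
    forall z : {linear P 1%N -> A}, (forall x, z (d 1%N x) = 0) ->
    exists b : {linear P 0%N -> A}, forall x, z x = b (d 0%N x).

Definition absolutely_clean (R : pzRingType) (A : lmodType R^c) : Prop :=
  forall F : lmodType R^c, FP_infty F -> Ext1_eq0 F A.

(* - (x)_R M is an exact functor                                              *)
Definition flat (R : pzRingType) (M : lmodType R) : Prop :=
  forall (A B C : lmodType R^c) (f : {linear A -> B}) (g : {linear B -> C}),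
    exact f g ->
    exact (tensor_map f (@idfun M)) (tensor_map g (@idfun M)).

(* d i goes from degree i + 1 to degree i, which makes the composites         *)
(* d i \o d (i + 1) well typed without transport.                             *)
Definition ac_flat_complex (R : pzRingType) (F : int -> lmodType R)
    (d : forall i : int, {linear F (i + 1) -> F i}) : Prop :=
  [/\ forall i, flat (F i),
      forall i, exact (d (i + 1)) (d i)
    & forall A : lmodType R^c, absolutely_clean A -> forall i,
        exact (tensor_map (@idfun A) (d (i + 1))) (tensor_map (@idfun A) (d i))].

Definition is_kernel (R : pzRingType) (M U V : lmodType R)
    (d : {linear U -> V}) : Prop :=
  exists k : {linear M -> U}, injective k /\ exact k d.

Definition gorenstein_ac_flat (R : pzRingType) (M : lmodType R) : Prop :=
  exists (F : int -> lmodType R) (d : forall i : int, {linear F (i + 1) -> F i}),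
    ac_flat_complex d /\ exists i : int, is_kernel M (d i).

Definition strongly_gorenstein_ac_flat (R : pzRingType) (M : lmodType R) :
    Prop :=
  exists (F : lmodType R) (d : {linear F -> F}),
    @ac_flat_complex R (fun=> F) (fun=> d) /\ is_kernel M d.

Definition direct_summand (R : pzRingType) (M S : lmodType R) : Prop :=
  exists (N : lmodType R) (f : {linear (M * N)%type -> S}), bijective f.

Definition closed_under_extensions (R : pzRingType) (C : lmodType R -> Prop) :
    Prop :=
  forall (L E N : lmodType R) (f : {linear L -> E}) (g : {linear E -> N}),
    injective f -> exact f g -> surjective g -> C L -> C N -> C E.

(* Main.v *)
Require Import Defs.
From HB Require Import structures.
From mathcomp Require Import all_boot all_algebra.
From mathcomp Require Import boolp generic_quotient ring_quotient freeg.

(** Both parts rest on cutting complexes into short exact sequences.  Call L a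
    syzygy of M when there is an exact sequence 0 -> L -> F -> M -> 0 with F
    flat, such that A (x) L -> A (x) F stays injective for every absolutely
    clean A.  A module M is Gorenstein AC-flat exactly when it is a term Z 0
    of a family Z indexed by the integers in which Z (i + 1) is a syzygy of
    Z i for all i ([gorenstein_of_chain], [gorenstein_chain]): the cycles of a
    complex form such a family, and such a family is spliced into a complex,
    which remains exact after A (x) - because the tensor product is right
    exact ([tensor_map_exact]).  Being a syzygy is a mere proposition about
    two modules, so that chains of syzygies are obtained from a class of
    modules which has both a syzygy and a module of which it is a syzygy at
    each of its members ([chain_of_class]).

    Direct sums preserve syzygies ([syzygy_dirsum]).  Hence, if Z is a chain
    with Z 0 = M, the direct sum S of all the Z i is, up to shifting the
    summands by one place, a syzygy of itself; repeating this single sequence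
    shows that S is strongly Gorenstein AC-flat, and M is one of its summands.

    For the second part, let M be a direct summand of a Gorenstein AC-flat N,
    and let W be the direct sum of countably many copies of N, which is
    Gorenstein AC-flat too.  By the Eilenberg swindle there is a split exact
    sequence 0 -> M -> W -> W -> 0, together with a splitting W -> M.  Choose
    0 -> W1 -> F -> W -> 0 and 0 -> W -> F' -> W2 -> 0 exhibiting W1 as a
    syzygy of W and W as a syzygy of W2, with W1 and W2 Gorenstein AC-flat.
    The kernel L of F -> W -> M is an extension of W by W1, and the cokernel H
    of M -> W -> F' is an extension of W2 by W.  Closure under extensions
    makes L and H Gorenstein AC-flat; L is a syzygy of M and M is a syzygy of
    H ([retract_syzygies]).  Thus [chain_of_class] applies to the class of
    direct summands of Gorenstein AC-flat modules. *)

Set Implicit Arguments.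
Unset Strict Implicit.
Unset Printing Implicit Defensive.

Import GRing.Theory.
Local Open Scope ring_scope.
Local Open Scope quotient_scope.

(** * Submodules and quotient modules *)

Definition linear_of (R : pzRingType) (U V : lmodType R) (f : U -> V)
    (fL : linear f) : {linear U -> V} :=
  HB.pack f (GRing.isLinear.Build R U V *:%R f fL).

Section SubQuotient.
Variables (R : pzRingType) (U : lmodType R) (P : U -> Prop).
Hypotheses (P0 : P 0) (PL : forall a u v, P u -> P v -> P (a *: u + v)).

Definition submod_pred : {pred U} := fun x => `[< P x >].
Local Notation S := submod_pred.

Fact submod_closedS : submod_closed S.
Proof.
split=> [|a u v /asboolP Pu /asboolP Pv]; apply/asboolP; first exact: P0.
exact: PL.
Qed.
HB.instance Definition _ := GRing.isSubmodClosed.Build R U S submod_closedS.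
Let K := {x : U | x \in S}.
HB.instance Definition _ := SubChoice.on K.
HB.instance Definition _ := [SubChoice_isSubLmodule of K by <:].

Definition submodule : lmodType R := K.
Definition submod_val : {linear submodule -> U} := (val : {linear K -> U}).
Definition submod_elt x (Px : P x) : submodule := exist _ x (asboolT Px).

Lemma submod_val_inj : injective submod_val.
Proof. exact: val_inj. Qed.

Lemma submod_valP x : P (submod_val x).
Proof. by apply/asboolP; exact: (valP x). Qed.
Let Q : Type := Quotient.quot S.
HB.instance Definition _ := GRing.Zmodule.on Q.

Let pr (u : U) : Q := \pi_(Quotient.quot S) u.
Let prP u v : reflect (pr u = pr v) (u - v \in S).
Proof. by rewrite Quotient.idealrBE; apply: eqP. Qed.
Let qscale (a : R) (x : Q) : Q := pr (a *: repr (x : Quotient.quot S)).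
Let prZ a u : qscale a (pr u) = pr (a *: u).
Proof.
apply/prP; rewrite -scalerBr.
have /prP/asboolP H : pr (repr (\pi_(Quotient.quot S) u)) = pr u.
  by rewrite /pr reprK.
by apply/asboolP; rewrite -[_ *: _]addr0; apply: PL.
Qed.
Let prD u v : pr (u + v) = pr u + pr v.
Proof. exact: raddfD. Qed.
Let prK (x : Q) : pr (repr (x : Quotient.quot S)) = x.
Proof. exact: reprK. Qed.
Let qscaleA a b x : qscale a (qscale b x) = qscale (a * b) x.
Proof. by rewrite -[x]prK !prZ scalerA. Qed.
Let qscale1 : left_id 1 qscale.
Proof. by move=> x; rewrite -[x]prK prZ scale1r. Qed.
Let qscaleDr : right_distributive qscale +%R.
Proof. by move=> a x y; rewrite -[x]prK -[y]prK -prD !prZ scalerDr prD. Qed.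
Let qscaleDl x : {morph qscale^~ x : a b / a + b}.
Proof. by move=> a b; rewrite -[x]prK !prZ scalerDl prD. Qed.
HB.instance Definition _ :=
  GRing.Zmodule_isLmodule.Build R Q qscaleA qscale1 qscaleDr qscaleDl.
Let pr_linear : linear pr.
Proof. by move=> a u v; rewrite prD -prZ. Qed.

(** The quotient group carries the scalar action computed on representatives,
    which is compatible with the projection because [P] is stable under
    scaling. *)
Lemma quotient_exists : exists (Q : lmodType R) (q : {linear U -> Q}),
  surjective q /\ forall x, q x = 0 <-> P x.
Proof.
exists Q, (linear_of pr_linear); split=> [y|x /=].
  by exists (repr (y : Quotient.quot S)); exact: prK.
have <- : pr 0 = 0 by exact: raddf0.
split=> [/prP/asboolP|Px]; first by rewrite subr0.
by apply/prP/asboolP; rewrite subr0.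
Qed.
End SubQuotient.

(** * The tensor product as a functor *)

Section TensorFunctor.
Variable R : pzRingType.

(** Closure under subtraction suffices, since it yields zero, opposites
    and sums, hence all integral combinations of elementary tensors. *)
Lemma tensor_ind (A : lmodType R^c) (M : lmodType R) (P : tensor A M -> Prop) :
  (forall a m, P (tens a m)) -> (forall t u, P t -> P u -> P (t - u)) ->
  forall t, P t.
Proof.
move=> Ptens PB t.
have P0 : P 0 by rewrite -(subrr (tens 0 0)); apply: PB.
have PN u : P u -> P (- u) by move=> Pu; rewrite -sub0r; apply: PB.
have PD u v : P u -> P v -> P (u + v).
  by move=> Pu Pv; rewrite -[v]opprK; apply/PB/PN.
have PMn u n : P u -> P (u *+ n).
  by move=> Pu; elim: n => [|n IH]; rewrite ?mulr0n // mulrS; apply: PD.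
have PMz u z : P u -> P (u *~ z).
  by case: z => n Pu; [exact: PMn|apply/PN/PMn].
rewrite -[t]reprK -[repr t]freeg_sumE raddf_sum /=.
elim: (dom _) => [|z s IH]; rewrite ?big_nil // big_cons; apply: PD => //.
have -> : (<< coeff z (repr t) *g z >> : free_pair A M) =
   pair_gen z.1 z.2 *~ coeff z (repr t).
  by rewrite /pair_gen freegU_mulz intz -surjective_pairing.
by rewrite raddfMz; apply/PMz/Ptens.
Qed.

Lemma tensor_map_ext (A : lmodType R^c) (M : lmodType R) (W : zmodType)
    (f g : tensor A M -> W) :
  {morph f : t u / t - u} -> {morph g : t u / t - u} ->
  (forall a m, f (tens a m) = g (tens a m)) -> f =1 g.
Proof.
move=> fB gB fg t.
by elim/tensor_ind: t => // t u IHt IHu; rewrite fB gB IHt IHu.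
Qed.

Lemma tensor_map_comp (A B C : lmodType R^c) (M N P : lmodType R)
    (f : {linear A -> B}) (f' : {linear B -> C})
    (g : {linear M -> N}) (g' : {linear N -> P}) t :
  tensor_map f' g' (tensor_map f g t) = tensor_map (f' \o f) (g' \o g) t.
Proof.
move: t; apply: tensor_map_ext => [t u|t u|a m]; rewrite ?tensor_mapB //.
by rewrite !tensor_map_tens.
Qed.

Lemma tensor_mapC (A B : lmodType R^c) (M N : lmodType R)
    (f : {linear A -> B}) (g : {linear M -> N}) t :
  tensor_map f idfun (tensor_map idfun g t) =
  tensor_map idfun g (tensor_map f idfun t).
Proof. by rewrite !tensor_map_comp. Qed.

Lemma eq_tensor_map (A B : lmodType R^c) (M N : lmodType R)
    (f f' : A -> B) (g g' : M -> N) :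
  f =1 f' -> g =1 g' -> tensor_map f g =1 tensor_map f' g'.
Proof. by move=> /funext -> /funext ->. Qed.

Lemma tensor_map_id (A : lmodType R^c) (M : lmodType R) (t : tensor A M) :
  tensor_map idfun idfun t = t.
Proof.
by move: t; apply: tensor_map_ext => [t u|t u|a m];
  rewrite ?tensor_mapB // tensor_map_tens.
Qed.

Lemma tensDr (A : lmodType R^c) (M : lmodType R) (a : A) (m m' : M) :
  tens a (m + m') = tens a m + tens a m'.
Proof.
rewrite /tens -raddfD; apply/eqP; rewrite -Quotient.idealrBE.
exact/asboolP/tensor_relDr.
Qed.

Lemma tens0r (A : lmodType R^c) (M : lmodType R) (a : A) : tens a (0 : M) = 0.
Proof. by apply: (addIr (tens a 0)); rewrite -tensDr !add0r. Qed.

Lemma tensBr (A : lmodType R^c) (M : lmodType R) (a : A) (m m' : M) :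
  tens a (m - m') = tens a m - tens a m'.
Proof. by apply: (addIr (tens a m')); rewrite -tensDr !subrK. Qed.

Lemma tensDl (A : lmodType R^c) (M : lmodType R) (a a' : A) (m : M) :
  tens (a + a') m = tens a m + tens a' m.
Proof.
rewrite /tens -raddfD; apply/eqP; rewrite -Quotient.idealrBE.
exact/asboolP/tensor_relDl.
Qed.

Lemma tensZ (A : lmodType R^c) (M : lmodType R) (a : A) (r : R) (m : M) :
  tens ((r : R^c) *: a) m = tens a (r *: m).
Proof.
apply/eqP; rewrite -Quotient.idealrBE.
exact/asboolP/tensor_relZ.
Qed.

Lemma tens_sumr (A : lmodType R^c) (M : lmodType R) (a : A) (I : Type)
    (s : seq I) (m : I -> M) :
  tens a (\sum_(i <- s) m i) = \sum_(i <- s) tens a (m i).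
Proof.
elim: s => [|i s IH]; first by rewrite !big_nil tens0r.
by rewrite !big_cons tensDr IH.
Qed.

Lemma tensor_map_eq0 (A : lmodType R^c) (M N : lmodType R)
    (g : {linear M -> N}) (t : tensor A M) :
  (forall m, g m = 0) -> tensor_map (@idfun A) g t = 0.
Proof.
move=> g0; move: t.
apply: (tensor_map_ext (g := fun=> 0)) => [t u|t u|a m].
- exact: tensor_mapB.
- by rewrite subr0.
- by rewrite tensor_map_tens g0 tens0r.
Qed.

HB.instance Definition _ (A B : lmodType R^c) (M N : lmodType R)
    (f : {linear A -> B}) (g : {linear M -> N}) :=
  GRing.isZmodMorphism.Build (tensor A M) (tensor B N) (tensor_map f g)
    (tensor_mapB f g).

Lemma tensor_map_surj (A : lmodType R^c) (M N : lmodType R)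
    (g : {linear M -> N}) :
  surjective g -> surjective (tensor_map (@idfun A) g).
Proof.
move=> g_surj; elim/tensor_ind => [a n|t u [t' <-] [u' <-]].
  by have [m <-] := g_surj n; exists (tens a m); rewrite tensor_map_tens.
by exists (t' - u'); rewrite raddfB.
Qed.

(** Right exactness.  A set-theoretic section [s] of [g] induces an additive map
    [S] from formal sums of pairs over [N] to [tensor A M].  Since [s] is
    linear modulo the kernel of [g], which is the image of [f], the map [S]
    sends the defining relations of [tensor A N] into the image of
    A (x) f, and it inverts A (x) g modulo that image. *)
Lemma tensor_map_exact (A : lmodType R^c) (L M N : lmodType R)
    (f : {linear L -> M}) (g : {linear M -> N}) :
  exact f g -> surjective g ->
  exact (tensor_map (@idfun A) f) (tensor_map (@idfun A) g).
Proof.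
move=> fg g_surj t; split; last first.
  move=> [u <-]; rewrite tensor_map_comp.
  by apply: tensor_map_eq0 => x /=; apply/fg; exists x.
have [s sK] := choice g_surj.
pose I (v : tensor A M) := exists u, tensor_map (@idfun A) f u = v.
have IB v w : I v -> I w -> I (v - w).
  by move=> [u <-] [u' <-]; exists (u - u'); rewrite raddfB.
have I0 : I 0 by exists 0; rewrite raddf0.
have I_ker a m : g m = 0 -> I (tens a m).
  move=> /fg[x <-]; exists (tens a x); exact: tensor_map_tens.
pose S (x : free_pair A N) : tensor A M :=
  \pi_(Quotient.quot (@tensor_relb R A M)) (free_pair_map idfun s x).
have SB x y : S (x - y) = S x - S y.
  by rewrite -raddfB; congr (\pi _); exact: lift_is_additive.
have S0 : S 0 = 0 by rewrite -{1}(subrr 0) SB subrr.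
have SD x y : S (x + y) = S x + S y.
  by rewrite -{1}[y]opprK SB -[- y]sub0r SB S0 sub0r opprK.
have Sg a n : S (pair_gen a n) = tens a (s n).
  by rewrite /S /free_pair_map liftU scale1r.
have rel_I x : tensor_rel x -> I (S x).
  elim=> {x} [|x y _ Ix _ Iy|a a' m|a m m'|a r m].
  - by rewrite S0.
  - by rewrite SB; apply: IB.
  - by rewrite SB SD !Sg tensDl subrr.
  - rewrite SB SD !Sg -tensDr -tensBr; apply: I_ker.
    by rewrite linearB linearD !sK subrr.
  - rewrite SB !Sg tensZ -tensBr; apply: I_ker.
    by rewrite linearB linearZ !sK subrr.
(* [S] of a class is independent of the representative modulo the image. *)
have S_repr x : I (S (repr (\pi_(Quotient.quot (@tensor_relb R A N)) x)) - S x).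
  have /asboolP : repr (\pi_(Quotient.quot (@tensor_relb R A N)) x) - x
    \in @tensor_relb R A N by rewrite Quotient.idealrBE reprK.
  by rewrite -SB; apply: rel_I.
(* [S] is a left inverse of A (x) g modulo the image. *)
have St u : I (S (repr (tensor_map (@idfun A) g u)) - u).
  elim/tensor_ind: u => [a m|t1 t2 It1 It2].
    have := S_repr (pair_gen a (g m)); rewrite -/(tens a (g m)) Sg => I1.
    rewrite tensor_map_tens.
    have I2 : I (tens a m - tens a (s (g m))).
      by rewrite -tensBr; apply: I_ker; rewrite linearB sK subrr.
    by have := IB _ _ I1 I2; rewrite opprB addrA subrK.
  set r1 := repr _ in It1; set r2 := repr _ in It2.
  have := S_repr (r1 - r2).
  rewrite raddfB /= !reprK SB -tensor_mapB => I3.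
  have := IB _ _ I3 (IB _ _ It2 It1); congr I.
  rewrite [- (_ - _ - _)]opprB -addrA [- (S r2 - t2)]opprD addrACA.
  by rewrite -opprD addKr.
move=> t0.
have := St t; rewrite t0 => It.
have I1 : I (S (repr (0 : tensor A N))).
  by have := S_repr 0; rewrite raddf0 S0 subr0.
by have := IB _ _ I1 It; rewrite subKr.
Qed.
End TensorFunctor.

(** * Componentwise arguments *)

Section Decomp.
Variable I : eqType.
(** An abelian group in which each element is the sum of finitely many of its
    components.  Direct sums have this property, and so do their tensor
    products, which makes it unnecessary to identify A (x) (sum of M_i) with
    the sum of the A (x) M_i.  The equation is required for all large enough
    finite index sets, so that the sets of two elements can be merged. *)
Record decomposition (Y : zmodType) (Y_ : I -> zmodType) := Decomposition {
  dinj : forall i, {additive Y_ i -> Y};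
  dprj : forall i, {additive Y -> Y_ i};
  dsum : forall y, exists s : seq I, forall s', uniq s' -> {subset s <= s'} ->
    y = \sum_(i <- s') dinj i (dprj i y) }.

Lemma decomp_ind Y Y_ (D : decomposition Y Y_) (P : Y -> Prop) :
  P 0 -> (forall y y', P y -> P y' -> P (y + y')) ->
  forall y, (forall i, P (dinj D i (dprj D i y))) -> P y.
Proof.
move=> P0 PD y Py; have [s /(_ (undup s))->] := dsum D y.
- by elim/big_ind: _.
- exact: undup_uniq.
- by move=> i; rewrite mem_undup.
Qed.

Lemma decomp_inj Y Y_ Z Z_ (DY : decomposition Y Y_) (DZ : decomposition Z Z_)
    (f : Y -> Z) (f_ : forall i, Y_ i -> Z_ i) :
  (forall i y, dprj DZ i (f y) = f_ i (dprj DY i y)) ->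
  (forall i y, f_ i y = 0 -> y = 0) ->
  forall y, f y = 0 -> y = 0.
Proof.
move=> fC f_inj y fy0.
apply: (decomp_ind (D := DY) (P := fun y' => y' = 0)) => // [_ _ -> ->|i].
  by rewrite addr0.
by rewrite (f_inj i (dprj DY i y)) ?raddf0 // -fC fy0 raddf0.
Qed.

Lemma decomp_surj Y Y_ Z Z_ (DY : decomposition Y Y_) (DZ : decomposition Z Z_)
    (f : {additive Y -> Z}) (f_ : forall i, Y_ i -> Z_ i) :
  (forall i y, f (dinj DY i y) = dinj DZ i (f_ i y)) ->
  (forall i, surjective (f_ i)) -> surjective f.
Proof.
move=> fC f_surj z.
apply: (decomp_ind (D := DZ) (P := fun z => exists y, f y = z)) 
  => [|_ _ [y <-] [y' <-]|i].
- by exists 0; rewrite raddf0.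
- by exists (y + y'); rewrite raddfD.
- have [y yz] := f_surj i (dprj DZ i z).
  by exists (dinj DY i y); rewrite fC yz.
Qed.

(** The projections carry a cycle to componentwise cycles, whose preimages are
    then reassembled by the injections. *)
Lemma decomp_exact X X_ Y Y_ Z Z_ (DX : decomposition X X_)
    (DY : decomposition Y Y_) (DZ : decomposition Z Z_)
    (f : {additive X -> Y}) (g : {additive Y -> Z})
    (f_ : forall i, X_ i -> Y_ i) (g_ : forall i, Y_ i -> Z_ i) :
  (forall i x, f (dinj DX i x) = dinj DY i (f_ i x)) ->
  (forall i y, g (dinj DY i y) = dinj DZ i (g_ i y)) ->
  (forall i y, dprj DZ i (g y) = g_ i (dprj DY i y)) ->
  (forall i, exact (f_ i) (g_ i)) -> exact f g.
Proof.
move=> fi gi gp fg y; split=> [gy0|[x <-]].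
  apply: (decomp_ind (D := DY) (P := fun y => exists x, f x = y))
    => [|_ _ [x <-] [x' <-]|i].
  - by exists 0; rewrite raddf0.
  - by exists (x + x'); rewrite raddfD.
  - have /fg[x xy] : g_ i (dprj DY i y) = 0 by rewrite -gp gy0 raddf0.
    by exists (dinj DX i x); rewrite fi xy.
apply: (decomp_ind (D := DX) (P := fun x => g (f x) = 0))
  => [|x1 x2 x1g x2g|i].
- by rewrite !raddf0.
- by rewrite !raddfD x1g x2g addr0.
rewrite fi gi (_ : g_ i _ = 0) ?raddf0 //; apply/fg.
by exists (dprj DX i x).
Qed.

Variable R : pzRingType.
Record lin_decomposition (M : lmodType R) (M_ : I -> lmodType R) :=
  LinDecomposition {
  linj : forall i, {linear M_ i -> M};
  lprj : forall i, {linear M -> M_ i};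
  lsum : forall y, exists s : seq I, forall s', uniq s' -> {subset s <= s'} ->
    y = \sum_(i <- s') linj i (lprj i y) }.

Definition decomp_of_lin M M_ (D : lin_decomposition M M_) :
    decomposition M M_ :=
  @Decomposition M M_ (linj D) (lprj D) (lsum D).

Lemma tensor_lsum (A : lmodType R^c) M M_ (D : lin_decomposition M M_)
   (t : tensor A M) : exists s : seq I, forall s', uniq s' ->
     {subset s <= s'} ->
   t = \sum_(i <- s') tensor_map (@idfun A) (linj D i)
                      (tensor_map (@idfun A) (lprj D i) t).
Proof.
elim/tensor_ind: t => [a m|t u [s sP] [s' s'P]].
  have [s sP] := lsum D m; exists s => s' us' ss'.
  rewrite {1}(sP s') // tens_sumr; apply: eq_bigr => i _.
  by rewrite !tensor_map_tens.
exists (s ++ s') => r ur ssr.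
rewrite {1}(sP r) //; last by move=> i si; apply: ssr; rewrite mem_cat si.
rewrite {1}(s'P r) //; last first.
  by move=> i si; apply: ssr; rewrite mem_cat si orbT.
by rewrite -sumrB; apply: eq_bigr => i _; rewrite !raddfB.
Qed.

Definition decomp_tensor (A : lmodType R^c) M M_ (D : lin_decomposition M M_) :
    decomposition (tensor A M) (fun i => tensor A (M_ i)) :=
  @Decomposition (tensor A M) (fun i => tensor A (M_ i))
    (fun i => tensor_map (@idfun A) (linj D i))
    (fun i => tensor_map (@idfun A) (lprj D i)) (tensor_lsum D).

End Decomp.

(** * Direct sums of modules *)

Section Prod.
Variables (R : pzRingType) (I : Type) (F : I -> lmodType R).
Definition pi_module : Type := forall i, F i.
HB.instance Definition _ := gen_eqMixin pi_module.
HB.instance Definition _ := gen_choiceMixin pi_module.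
Let dext (x y : pi_module) : (forall i, x i = y i) -> x = y.
Proof. exact: functional_extensionality_dep. Qed.
Let add (x y : pi_module) : pi_module := fun i => x i + y i.
Let opp (x : pi_module) : pi_module := fun i => - x i.
Let zero : pi_module := fun=> 0.
Let scale (a : R) (x : pi_module) : pi_module := fun i => a *: x i.
Let addA : associative add.
Proof. by move=> x y z; apply: dext => i; apply: addrA. Qed.
Let addC : commutative add.
Proof. by move=> x y; apply: dext => i; apply: addrC. Qed.
Let add0 : left_id zero add.
Proof. by move=> x; apply: dext => i; apply: add0r. Qed.
Let addN : left_inverse zero opp add.
Proof. by move=> x; apply: dext => i; apply: addNr. Qed.
HB.instance Definition _ := GRing.isZmodule.Build pi_module addA addC add0 addN.
Let scaleA a b x : scale a (scale b x) = scale (a * b) x.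
Proof. by apply: dext => i; apply: scalerA. Qed.
Let scale1 : left_id 1 scale.
Proof. by move=> x; apply: dext => i; apply: scale1r. Qed.
Let scaleDr : right_distributive scale +%R.
Proof. by move=> a x y; apply: dext => i; apply: scalerDr. Qed.
Let scaleDl x : {morph scale^~ x : a b / a + b}.
Proof. by move=> a b; apply: dext => i; apply: scalerDl. Qed.
HB.instance Definition _ :=
  GRing.Zmodule_isLmodule.Build R pi_module scaleA scale1 scaleDr scaleDl.
End Prod.

Section DirectSum.
Variables (R : pzRingType) (I : eqType) (F : I -> lmodType R).

Definition fin_supp (x : pi_module F) : Prop :=
  exists s : seq I, forall i, i \notin s -> x i = 0.
Fact fin_supp0 : fin_supp 0.
Proof. by exists [::]. Qed.
Fact fin_suppL a x y : fin_supp x -> fin_supp y -> fin_supp (a *: x + y).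
Proof.
move=> [s xs] [s' ys].
exists (s ++ s') => i; rewrite mem_cat => /norP[/xs xi /ys yi].
by rewrite -[LHS]/(a *: x i + y i) xi yi scaler0 addr0.
Qed.

Definition dirsum : lmodType R := submodule fin_supp0 fin_suppL.

Definition component i (x : dirsum) : F i :=
  submod_val fin_supp0 fin_suppL x i.
Fact component_linear i : linear (component i).
Proof. by move=> a x y; rewrite /component linearP. Qed.
HB.instance Definition _ i :=
  GRing.isLinear.Build R dirsum (F i) *:%R (component i) (@component_linear i).

Lemma dirsumP (x y : dirsum) :
  (forall i, component i x = component i y) -> x = y.
Proof.
move=> xy; apply: (@submod_val_inj _ _ _ fin_supp0 fin_suppL).
exact: functional_extensionality_dep.
Qed.

Lemma component_fin (x : dirsum) :
  exists s : seq I, forall i, i \notin s -> component i x = 0.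
Proof. exact: (@submod_valP _ _ _ fin_supp0 fin_suppL x). Qed.

Section Tuple.
Variables (U : lmodType R) (h : forall i, U -> F i).
Hypotheses (hL : forall i, linear (h i))
  (hfin : forall u, exists s : seq I, forall i, i \notin s -> h i u = 0).

Let tuple (u : U) : dirsum :=
  submod_elt fin_supp0 fin_suppL (x := fun i => h i u) (hfin u).
Let tuple_linear : linear tuple.
Proof. by move=> a u v; apply: dirsumP => i; rewrite linearP; apply: hL. Qed.
Definition dirsum_tuple : {linear U -> dirsum} := linear_of tuple_linear.
Lemma component_tuple i u : component i (dirsum_tuple u) = h i u.
Proof. by []. Qed.
End Tuple.

Definition dirsum_single i (u : F i) : pi_module F :=
  @dfwith I (fun j => F j) (fun=> 0) i u.
Fact dirsum_single_linear i j : linear (fun u : F i => dirsum_single u j).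
Proof.
move=> a u v; rewrite /dirsum_single; have [ij|ij] := eqVneq i j.
  by case: _ / ij; rewrite !dfwith_in.
by rewrite !dfwith_out // scaler0 addr0.
Qed.
Fact dirsum_single_fin i (u : F i) :
  exists s : seq I, forall j, j \notin s -> dirsum_single u j = 0.
Proof.
exists [:: i] => j; rewrite inE eq_sym => ij.
by rewrite /dirsum_single dfwith_out.
Qed.
Definition dirsum_in i : {linear F i -> dirsum} :=
  dirsum_tuple (@dirsum_single_linear i) (@dirsum_single_fin i).

Lemma component_in i u : component i (dirsum_in i u) = u.
Proof. exact: dfwith_in. Qed.
Lemma component_in_ne i j u : i != j -> component j (dirsum_in i u) = 0.
Proof. exact: dfwith_out. Qed.

Lemma dirsum_dsum (x : dirsum) : exists s : seq I, forall s', uniq s' ->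
  {subset s <= s'} -> x = \sum_(i <- s') dirsum_in i (component i x).
Proof.
have [s xs] := component_fin x; exists s => s' us' ss'.
apply: dirsumP => i; rewrite linear_sum /=.
have [is'|is'] := boolP (i \in s').
  rewrite (bigD1_seq i) //= component_in big1 ?addr0 // => j ji.
  by rewrite component_in_ne.
rewrite big1_seq => [|j /andP[_ js']].
  by apply: xs; apply: contra is'; apply: ss'.
by rewrite component_in_ne //; apply: contraNneq is' => <-.
Qed.

Definition dirsum_decomp : lin_decomposition dirsum F :=
  @LinDecomposition I R dirsum F dirsum_in (fun i => component i) dirsum_dsum.
End DirectSum.
Arguments dirsum_tuple : simpl never.
Arguments dirsum_in : simpl never.

Section DirectSumMap.
Variables (R : pzRingType) (I : eqType) (F G : I -> lmodType R).
Variable f : forall i, {linear F i -> G i}.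
Fact map_component_linear i : linear (fun x : dirsum F => f i (component i x)).
Proof. by move=> a x y; rewrite !linearP. Qed.
Fact map_component_fin (x : dirsum F) :
  exists s : seq I, forall i, i \notin s -> f i (component i x) = 0.
Proof.
by have [s xs] := component_fin x; exists s => i /xs ->; rewrite linear0.
Qed.
Definition dirsum_map : {linear dirsum F -> dirsum G} :=
  dirsum_tuple map_component_linear map_component_fin.

Lemma component_map i x : component i (dirsum_map x) = f i (component i x).
Proof. by []. Qed.
Lemma dirsum_map_in i u :
  dirsum_map (dirsum_in F i u) = dirsum_in G i (f i u).
Proof.
apply: dirsumP => j; rewrite component_map.
have [ij|ij] := eqVneq i j; first by case: _ / ij; rewrite !component_in.
by rewrite !component_in_ne // linear0.
Qed.
End DirectSumMap.
Arguments dirsum_map : simpl never.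

Section DirectSumExact.
Variables (R : pzRingType) (I : eqType).

Lemma dirsum_exact (F G H : I -> lmodType R)
    (f : forall i, {linear F i -> G i}) (g : forall i, {linear G i -> H i}) :
  (forall i, exact (f i) (g i)) -> exact (dirsum_map f) (dirsum_map g).
Proof.
apply: (decomp_exact (DX := decomp_of_lin (dirsum_decomp F))
  (DY := decomp_of_lin (dirsum_decomp G))
  (DZ := decomp_of_lin (dirsum_decomp H))) => i x //=;
  exact: dirsum_map_in.
Qed.

Lemma dirsum_surj (F G : I -> lmodType R) (f : forall i, {linear F i -> G i}) :
  (forall i, surjective (f i)) -> surjective (dirsum_map f).
Proof.
apply: (decomp_surj (DY := decomp_of_lin (dirsum_decomp F))
  (DZ := decomp_of_lin (dirsum_decomp G))) => i x /=;
  exact: dirsum_map_in.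
Qed.

(** For an exact sequence A -> B -> C, tensoring with a direct sum gives a
    sequence that is exact componentwise. *)
Lemma dirsum_flat (F : I -> lmodType R) :
  (forall i, flat (F i)) -> flat (dirsum F).
Proof.
move=> fF A B C f g fg.
apply: (decomp_exact (DX := decomp_tensor A (dirsum_decomp F))
  (DY := decomp_tensor B (dirsum_decomp F))
  (DZ := decomp_tensor C (dirsum_decomp F))
  (f_ := fun i => tensor_map f idfun) (g_ := fun i => tensor_map g idfun)).
- by move=> i x; apply: tensor_mapC.
- by move=> i x; apply: tensor_mapC.
- by move=> i x; apply: esym; apply: tensor_mapC.
- by move=> i; apply: fF.
Qed.

Lemma tensor_dirsum_inj (A : lmodType R^c) (F G : I -> lmodType R)
    (f : forall i, {linear F i -> G i}) :
  (forall i t, tensor_map (@idfun A) (f i) t = 0 -> t = 0) ->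
  forall t, tensor_map (@idfun A) (dirsum_map f) t = 0 -> t = 0.
Proof.
apply: (decomp_inj (DY := decomp_tensor A (dirsum_decomp F))
  (DZ := decomp_tensor A (dirsum_decomp G))) => i t.
rewrite -[LHS]/(tensor_map (@idfun A) (@component R I G i) _).
rewrite -[RHS]/(tensor_map (@idfun A) (f i)
                  (tensor_map (@idfun A) (@component R I F i) t)).
by rewrite !tensor_map_comp.
Qed.
End DirectSumExact.

(** * Kernels, cokernels and retracts *)

Section LinearMaps.
Variable R : pzRingType.

Lemma injective_ker0 (U V : zmodType) (f : {additive U -> V}) :
  (forall x, f x = 0 -> x = 0) -> injective f.
Proof.
by move=> f0 x y fxy; apply/subr0_eq/f0; rewrite raddfB fxy subrr.
Qed.

Lemma factor_through_inj (K U V : lmodType R) (k : {linear K -> U})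
    (f : {linear V -> U}) : injective k -> (forall v, exists x, k x = f v) ->
  exists g : {linear V -> K}, forall v, k (g v) = f v.
Proof.
move=> k_inj /choice[g gk].
have gL : linear g by move=> a u v; apply: k_inj; rewrite linearP !gk linearP.
by exists (linear_of gL).
Qed.

Lemma factor_through_surj (U Q V : lmodType R) (q : {linear U -> Q})
    (f : {linear U -> V}) : surjective q -> (forall u, q u = 0 -> f u = 0) ->
  exists g : {linear Q -> V}, forall u, g (q u) = f u.
Proof.
move=> /choice[s sq] qf.
have fq u v : q u = q v -> f u = f v.
  by move=> quv; apply/subr0_eq; rewrite -linearB qf // linearB quv subrr.
have gL : linear (f \o s).
  move=> a x y /=; rewrite -linearP; apply: fq.
  by rewrite linearP !sq.
by exists (linear_of gL) => u /=; apply: fq; rewrite sq.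
Qed.

Lemma linear_inverse (U V : lmodType R) (f : {linear U -> V}) :
  injective f -> surjective f ->
  exists g : {linear V -> U}, cancel f g /\ cancel g f.
Proof.
move=> f_inj f_surj.
have [g gf] := @factor_through_inj _ _ _ f idfun f_inj f_surj.
by exists g; split=> // u; apply: f_inj; rewrite gf.
Qed.

Lemma kernel_exists (U V : lmodType R) (f : {linear U -> V}) :
  exists K : lmodType R, is_kernel K f.
Proof.
pose P u := f u = 0.
have f0 : P 0 by exact: linear0.
have fL a u v : P u -> P v -> P (a *: u + v).
  by rewrite /P => u0 v0; rewrite linearP u0 v0 scaler0 addr0.
exists (submodule f0 fL), (submod_val f0 fL).
split=> [|y]; first exact: submod_val_inj.
split=> [y0|[x <-]]; last exact: (submod_valP x).
by exists (submod_elt f0 fL y0).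
Qed.

Lemma cokernel_exists (U V : lmodType R) (f : {linear U -> V}) :
  exists (Q : lmodType R) (q : {linear V -> Q}), surjective q /\ exact f q.
Proof.
apply: (@quotient_exists R V (fun y => exists x, f x = y)).
  by exists 0; rewrite linear0.
by move=> a _ _ [x <-] [y <-]; exists (a *: x + y); rewrite linearP.
Qed.

Definition retract (M N : lmodType R) : Prop :=
  exists (a : {linear M -> N}) (b : {linear N -> M}), cancel a b.

Lemma retract_refl (M : lmodType R) : retract M M.
Proof. by exists idfun, idfun. Qed.

(** A direct summand is replaced by a pair of maps, so that no complement has to
    be carried along; conversely the kernel of the retraction is a
    complement. *)
Lemma direct_summandP (M N : lmodType R) : direct_summand M N <-> retract M N.
Proof.
split=> [[K [f f_bij]]|[a [b ab]]].
  have f_surj : surjective f by case: f_bij => g _ gf y; exists (g y).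
  have [g [fg gf]] := linear_inverse (bij_inj f_bij) f_surj.
  have iL : linear (fun m : M => f (m, 0)).
    move=> c u v; rewrite -linearP; congr (f _).
    rewrite -[RHS]/(c *: u + v, c *: (0 : K) + 0).
    by rewrite scaler0 addr0.
  have pL : linear (fun n : N => (g n).1) by move=> c u v; rewrite linearP.
  by exists (linear_of iL), (linear_of pL) => m /=; rewrite fg.
have [K [k [k_inj kb]]] := kernel_exists b.
have fL : linear (fun x : M * K => a x.1 + k x.2).
  by move=> c x y /=; rewrite !linearP scalerDr addrACA.
exists K, (linear_of fL).
have [h hk] : exists h : {linear N -> K}, forall n, k (h n) = n - a (b n).
  have dL : linear (fun n => n - a (b n)).
    by move=> c u v /=; rewrite (linearP b) (linearP a) opprD addrACA scalerBr.
  apply: (@factor_through_inj _ _ _ k (linear_of dL) k_inj) => n.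
  by apply/kb => /=; rewrite linearB /= ab subrr.
have bk x : b (k x) = 0 by apply/kb; exists x.
exists (fun n => (b n, h n)) => [[m x]|n] /=; last by rewrite hk addrC subrK.
have bE : b (a m + k x) = m by rewrite linearD /= ab bk addr0.
by rewrite bE; congr (_, _); apply: k_inj; rewrite hk bE addrC addKr.
Qed.

Lemma tensor_retract_inj (A : lmodType R^c) (M N : lmodType R)
    (a : {linear M -> N}) (b : {linear N -> M}) (t : tensor A M) :
  cancel a b -> tensor_map (@idfun A) a t = 0 -> t = 0.
Proof.
move=> ab /(congr1 (tensor_map (@idfun A) b)).
rewrite raddf0 tensor_map_comp => <-; rewrite -[LHS]tensor_map_id.
by apply: eq_tensor_map => x //=; rewrite ab.
Qed.

End LinearMaps.

(** * Syzygies relative to absolutely clean modules *)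

Section Syzygy.
Variable R : pzRingType.

Definition ac_injective (L F : lmodType R) (j : L -> F) : Prop :=
  forall A : lmodType R^c, absolutely_clean A ->
  forall t : tensor A L, tensor_map (@idfun A) j t = 0 -> t = 0.

Definition syzygy_sequence (M L F : lmodType R)
    (j : {linear L -> F}) (p : {linear F -> M}) : Prop :=
  [/\ flat F, injective j, exact j p, surjective p & ac_injective j].

(** Existence of the sequence, as a proposition: it can be rewritten along
    equalities of integers indexing modules, which the maps themselves
    cannot. *)
Definition syzygy (M L : lmodType R) : Prop :=
  exists (F : lmodType R) (j : {linear L -> F}) (p : {linear F -> M}),
    syzygy_sequence j p.

Lemma splice_exact (Z1 Z2 F0 F1 F2 : lmodType R)
    (j0 : {linear Z1 -> F0}) (p1 : {linear F1 -> Z1})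
    (j1 : {linear Z2 -> F1}) (p2 : {linear F2 -> Z2}) :
  injective j0 -> exact j1 p1 -> surjective p2 ->
  exact (j1 \o p2) (j0 \o p1).
Proof.
move=> j0_inj ex1 p2_surj y; split=> [/= jpy|[x <-] /=].
  have /ex1[z zy] : p1 y = 0 by apply: j0_inj; rewrite jpy linear0.
  by have [x xz] := p2_surj z; exists x; rewrite /= xz.
by rewrite (_ : p1 _ = 0) ?linear0 //; apply/ex1; exists (p2 x).
Qed.

(** After tensoring, [p1] is still the cokernel of [j1] and [p2] is still
    surjective, while [j0] stays injective by hypothesis: the two sequences
    splice as they do before tensoring. *)
Lemma tensor_splice_exact (A : lmodType R^c) (Z1 Z2 F0 F1 F2 : lmodType R)
    (j0 : {linear Z1 -> F0}) (p1 : {linear F1 -> Z1})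
    (j1 : {linear Z2 -> F1}) (p2 : {linear F2 -> Z2}) :
  absolutely_clean A -> ac_injective j0 ->
  exact j1 p1 -> surjective p1 -> surjective p2 ->
  exact (tensor_map (@idfun A) (j1 \o p2)) (tensor_map (@idfun A) (j0 \o p1)).
Proof.
move=> acA j0_inj ex1 p1_surj p2_surj t.
have tex := tensor_map_exact (A := A) ex1 p1_surj.
rewrite -[X in X = 0](tensor_map_comp idfun idfun p1 j0).
split=> [/(j0_inj _ acA)/tex[u <-]|[x <-]].
  have [v <-] := tensor_map_surj (A := A) p2_surj u.
  by exists v; rewrite tensor_map_comp.
rewrite -(tensor_map_comp idfun idfun p2 j1).
rewrite (_ : tensor_map _ p1 _ = 0) ?raddf0 //; apply/tex.
by eexists.
Qed.
Lemma syzygy_choice (I : Type) (M L : I -> lmodType R) :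
  (forall i, syzygy (M i) (L i)) ->
  exists (F : I -> lmodType R) (j : forall i, {linear L i -> F i})
    (p : forall i, {linear F i -> M i}), forall i, syzygy_sequence (j i) (p i).
Proof.
move=> ML.
pose T i := {F : lmodType R & ({linear L i -> F} * {linear F -> M i})%type}.
have D i : {x : T i | syzygy_sequence (projT2 x).1 (projT2 x).2}.
  by apply: cid; have [F [j [p jp]]] := ML i; exists (existT _ F (j, p)).
exists (fun i => projT1 (sval (D i))), (fun i => (projT2 (sval (D i))).1).
by exists (fun i => (projT2 (sval (D i))).2) => i; exact: svalP (D i).
Qed.

(** A linear bijection has a linear inverse, so it stays injective after
    tensoring. *)
Lemma syzygy_precomp_bij (M L L' : lmodType R) (g : {linear L' -> L}) :
  injective g -> surjective g -> syzygy M L -> syzygy M L'.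
Proof.
move=> g_inj g_surj [F [j [p [fF j_inj ex p_surj j_ac]]]].
have [h [gh hg]] := linear_inverse g_inj g_surj.
exists F, (j \o g), p; split=> //; first exact: inj_comp.
  move=> y; split=> [/ex[x <-]|[x <-]]; last by apply/ex; exists (g x).
  by exists (h x); rewrite /= hg.
move=> A acA t; rewrite -[X in X = _](tensor_map_comp idfun idfun g j).
by move=> /(j_ac _ acA); exact: tensor_retract_inj gh.
Qed.

Lemma syzygy_dirsum (I : eqType) (M L : I -> lmodType R) :
  (forall i, syzygy (M i) (L i)) -> syzygy (dirsum M) (dirsum L).
Proof.
move=> /syzygy_choice[F [j [p jp]]].
have j0 i x : j i x = 0 -> x = 0.
  by case: (jp i) => _ j_inj _ _ _ jx; apply: j_inj; rewrite jx linear0.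
exists (dirsum F), (dirsum_map j), (dirsum_map p); split.
- by apply: dirsum_flat => i; case: (jp i).
- apply: injective_ker0 => x jx; apply: dirsumP => i.
  by rewrite linear0; apply: j0; rewrite -component_map jx linear0.
- by apply: dirsum_exact => i; case: (jp i).
- by apply: dirsum_surj => i; case: (jp i).
- move=> A acA; apply: tensor_dirsum_inj => i t.
  by case: (jp i) => _ _ _ _; apply.
Qed.

(** * Gorenstein modules and chains of syzygies *)

(** The complex repeats the composite F -> S -> F in every degree. *)
Lemma strongly_of_syzygy (S : lmodType R) :
  syzygy S S -> strongly_gorenstein_ac_flat S.
Proof.
move=> [F [j [p [fF j_inj ex p_surj j_ac]]]].
exists F, (j \o p); split; last first.
  exists j; split=> // y; split=> [jpy|/ex py]; last by rewrite /= py linear0.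
  by apply/ex/j_inj; rewrite linear0.
split=> // [_|A acA _]; first exact: splice_exact.
exact: tensor_splice_exact.
Qed.

(** The differential F (i + 1) -> F i is the composite through Z (i + 1), so its
    kernel is Z (i + 2); every index has this form. *)
Lemma gorenstein_of_chain (Z : int -> lmodType R) :
  (forall i, syzygy (Z i) (Z (i + 1))) -> forall i, gorenstein_ac_flat (Z i).
Proof.
move=> /syzygy_choice[F [j [p jp]]].
pose d (i : int) : {linear F (i + 1) -> F i} := j i \o p (i + 1).
move=> i; rewrite -[i](subrK 1) -[i - 1](subrK 1).
set k := i - 1 - 1; exists F, d; split; last first.
  exists k, (j (k + 1)).
  have [_ jk_inj _ _ _] := jp k; have [_ j_inj ex _ _] := jp (k + 1).
  split=> // y; split=> [jpy|/ex py]; last by rewrite /d /= py linear0.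
  by apply/ex/jk_inj; rewrite linear0.
split=> [n|n|A acA n].
- by case: (jp n).
- have [_ j_inj _ _ _] := jp n; have [_ _ ex _ _] := jp (n + 1).
  by have [_ _ _ p_surj _] := jp (n + 1 + 1); apply: splice_exact.
- have [_ _ _ _ j_ac] := jp n; have [_ _ ex p1_surj _] := jp (n + 1).
  by have [_ _ _ p_surj _] := jp (n + 1 + 1); apply: tensor_splice_exact.
Qed.

(** Iterating a choice of syzygies gives the terms of nonnegative index, and
    iterating a choice in the opposite direction gives the others. *)
Lemma chain_of_class (C : lmodType R -> Prop) :
  (forall M, C M -> exists2 L, C L & syzygy M L) ->
  (forall M, C M -> exists2 H, C H & syzygy H M) ->
  forall M, C M -> exists Z : int -> lmodType R,
    Z 0 = M /\ forall i, syzygy (Z i) (Z (i + 1)).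
Proof.
move=> down up M CM; pose T := {M : lmodType R | C M}.
have /choice[next nextP] (x : T) : exists y : T, syzygy (sval x) (sval y).
  by have [L CL xL] := down _ (svalP x); exists (exist _ L CL).
have /choice[prev prevP] (x : T) : exists y : T, syzygy (sval y) (sval x).
  by have [L CL xL] := up _ (svalP x); exists (exist _ L CL).
pose x0 : T := exist _ M CM.
exists (fun i => match i with
  (* [Negz n] is - (n + 1), whence one more iteration. *)
  | Posz n => sval (iter n next x0) | Negz n => sval (iter n.+1 prev x0) end).
split=> // -[n|[|n]].
- by rewrite -PoszD addn1 iterS; apply: nextP.
- exact: prevP.
- have -> : Negz n.+1 + 1 = Negz n by rewrite !NegzE -addn1 PoszD opprD subrK.
  by rewrite (iterS n.+1); apply: prevP.
Qed.

(** Injectivity after tensoring: an element t of A (x) L killed in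
    A (x) F (i + 2) lifts to A (x) F (i + 3), where the lift is a cycle, hence
    a boundary, and boundaries vanish in A (x) L. *)
Lemma syzygy_of_complex (F : int -> lmodType R)
    (d : forall i : int, {linear F (i + 1) -> F i}) (i : int)
    (M L : lmodType R) :
  ac_flat_complex d -> is_kernel M (d i) -> is_kernel L (d (i + 1)) ->
  syzygy M L.
Proof.
move=> [fF exF exA] [k [k_inj kd]] [l [l_inj ld]].
have [p pk] : exists p : {linear F (i + 1 + 1) -> M},
    forall x, k (p x) = d (i + 1) x.
  by apply: factor_through_inj => // x; apply/kd/exF; exists x.
have [q ql] : exists q : {linear F (i + 1 + 1 + 1) -> L},
    forall x, l (q x) = d (i + 1 + 1) x.
  by apply: factor_through_inj => // x; apply/ld/exF; exists x.
have q_surj : surjective q.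
  move=> y; have /exF[x xy] : d (i + 1) (l y) = 0 by apply/ld; exists y.
  by exists x; apply: l_inj; rewrite ql.
exists (F (i + 1 + 1)), l, p; split=> //.
- move=> y; split=> [py|[x <-]]; first by apply/ld; rewrite -pk py linear0.
  by apply: k_inj; rewrite pk linear0; apply/ld; exists x.
- move=> m; have /exF[x xm] : d i (k m) = 0 by apply/kd; exists m.
  by exists x; apply: k_inj; rewrite pk.
- move=> A acA t; have [u <-] := tensor_map_surj (A := A) q_surj t.
  rewrite tensor_map_comp.
  rewrite (@eq_tensor_map _ _ _ _ _ _ idfun _ (d (i + 1 + 1))) //.
  move=> /(exA A acA)[v <-].
  rewrite tensor_map_comp; apply: tensor_map_eq0 => x /=.
  by apply: l_inj; rewrite ql linear0; apply/exF; exists x.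
Qed.

Lemma gorenstein_syzygy (M : lmodType R) : gorenstein_ac_flat M ->
  exists2 L, gorenstein_ac_flat L & syzygy M L.
Proof.
move=> [F [d [cF [i kM]]]]; have [L kL] := kernel_exists (d (i + 1)).
exists L; first by exists F, d; split=> //; exists (i + 1).
exact: syzygy_of_complex cF kM kL.
Qed.

(** The cycles one degree lower; the index of [M] is first written as a
    successor, since the differentials are typed by successors. *)
Lemma gorenstein_cosyzygy (M : lmodType R) : gorenstein_ac_flat M ->
  exists2 H, gorenstein_ac_flat H & syzygy H M.
Proof.
move=> [F [d [cF [i kM]]]].
have [i' ii'] : exists i', i = i' + 1 by exists (i - 1); rewrite subrK.
subst i; have [H kH] := kernel_exists (d i').
exists H; first by exists F, d; split=> //; exists i'.
exact: syzygy_of_complex cF kH kM.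
Qed.

Lemma gorenstein_chain (M : lmodType R) : gorenstein_ac_flat M ->
  exists Z : int -> lmodType R,
    Z 0 = M /\ forall i, syzygy (Z i) (Z (i + 1)).
Proof. exact: chain_of_class gorenstein_syzygy gorenstein_cosyzygy M. Qed.

(** Take the direct sum of countably many copies of a whole chain. *)
Lemma gorenstein_copower (M : lmodType R) : gorenstein_ac_flat M ->
  gorenstein_ac_flat (dirsum (fun _ : nat => M)).
Proof.
move=> /gorenstein_chain[Z [<- Zs]].
apply: (gorenstein_of_chain (Z := fun i => dirsum (fun _ : nat => Z i))).
by move=> i; apply: syzygy_dirsum.
Qed.

(** * Gorenstein modules are summands of strongly Gorenstein ones *)

Section Shift.
Variable Z : int -> lmodType R.
Fact dirsum_shift_linear (i : int) :
  linear (fun x : dirsum Z => component (i + 1) x).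
Proof. exact: linearP. Qed.
Fact dirsum_shift_fin (x : dirsum Z) :
  exists s : seq int, forall i, i \notin s -> component (i + 1) x = 0.
Proof.
have [s xs] := component_fin x; exists [seq k - 1 | k <- s] => i is'.
apply: xs; apply: contra is' => is'.
by apply/mapP; exists (i + 1); rewrite ?addrK.
Qed.
(** The components are unchanged; only the indexing moves, which makes the map
    definable without transporting elements along i - 1 + 1 = i. *)
Definition dirsum_shift : {linear dirsum Z -> dirsum (fun i => Z (i + 1))} :=
  dirsum_tuple (F := fun i => Z (i + 1)) dirsum_shift_linear dirsum_shift_fin.

Lemma dirsum_shift_inj : injective dirsum_shift.
Proof.
apply: injective_ker0 => x x0; apply: dirsumP => i; rewrite linear0.
have := congr1 (component (i - 1)) x0; rewrite linear0 component_tuple.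
by move: (i - 1) (subrK 1 i) => k <-.
Qed.

Lemma dirsum_shift_surj : surjective dirsum_shift.
Proof.
move=> y; apply: (decomp_ind
  (D := decomp_of_lin (dirsum_decomp (fun i => Z (i + 1))))
  (P := fun y => exists x, dirsum_shift x = y)) => [|_ _ [x <-] [x' <-]|i].
- by exists 0; rewrite linear0.
- by exists (x + x'); rewrite linearD.
exists (dirsum_in Z (i + 1) (component i y)).
apply: dirsumP => j; rewrite component_tuple /=.
have [<-|ij] := eqVneq i j; first by rewrite !component_in.
by rewrite !component_in_ne // (inj_eq (addIr 1)).
Qed.
End Shift.

(** The direct sum of a chain is a syzygy of itself once the syzygy sequence of
    the sums is reindexed by the shift. *)
Lemma gorenstein_summand_strongly (M : lmodType R) : gorenstein_ac_flat M ->
  exists S : lmodType R, strongly_gorenstein_ac_flat S /\ direct_summand M S.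
Proof.
move=> /gorenstein_chain[Z [<- Zs]]; exists (dirsum Z); split.
  apply: strongly_of_syzygy.
  exact: syzygy_precomp_bij (@dirsum_shift_inj Z) (@dirsum_shift_surj Z)
    (syzygy_dirsum Zs).
apply/direct_summandP; exists (dirsum_in Z 0), (@component R int Z 0) => m.
exact: component_in.
Qed.
End Syzygy.

(** * Summands of Gorenstein modules under extension closure *)

Section Swindle.
Variable R : pzRingType.

(** The sequence 0 -> M -> W -> V -> 0 given by [i] and [q], split by [r]
    and [s].  The relations r \o s = 0 and q \o i = 0 follow. *)
Definition split_sequence (M W V : lmodType R)
    (i : {linear M -> W}) (r : {linear W -> M})
    (s : {linear V -> W}) (q : {linear W -> V}) : Prop :=
  [/\ cancel i r, cancel s q & forall w, s (q w) + i (r w) = w].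

(** Write N = M + K.  A sequence in W is a sequence of pairs (m_n, k_n).  The
    submodule M sits in W as the coordinate m_0, and forgetting m_0 while
    moving the other m_n one place to the left, with the k_n fixed, is a
    quotient map from W onto W itself.  In the proof [a \o b] and [e] are the
    projections of N onto M and K; [pull] is this quotient map and [push] its
    section, which moves the m_n to the right and inserts m_0 = 0. *)
Lemma eilenberg_swindle (M N : lmodType R) : retract M N ->
  let W := dirsum (fun _ : nat => N) in
  exists (i : {linear M -> W}) (r : {linear W -> M}) (s q : {linear W -> W}),
    split_sequence i r s q.
Proof.
move=> [a [b ab]] W.
have eL : linear (fun x => x - a (b x)).
  by move=> k u v; rewrite (linearP b) (linearP a) opprD addrACA scalerBr.
pose e : {linear N -> N} := linear_of eL.
have be x : b (e x) = 0 by rewrite /= linearB /= ab subrr.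
have abe x : a (b x) + e x = x by rewrite /= addrC subrK.
have ea x : e (a x) = 0 by rewrite /= ab subrr.
have ee x : e (e x) = e x.
  by rewrite -[RHS]subr0 -[in X in _ - X](linear0 a) -(be x).
clearbody e; clear eL.
pose c n (w : W) : N := component n w.
have cP n k u v : c n (k *: u + v) = k *: c n u + c n v by rewrite /c linearP.
pose push n (w : W) : N :=
  (if n is n'.+1 then a (b (c n' w)) else 0) + e (c n w).
have pushL n : linear (push n).
  move=> k u v; case: n => [|n].
    by rewrite /push !add0r cP linearP.
  by rewrite /push !cP !linearP scalerDr addrACA.
have push_fin (w : W) :
    exists t : seq nat, forall n, n \notin t -> push n w = 0.
  have [t wt] := component_fin w; exists (t ++ map S t) => -[|n].
    rewrite mem_cat => /norP[/wt w0 _].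
    by rewrite /push /c w0 !linear0 addr0.
  rewrite mem_cat => /norP[/wt w1 nt].
  have w0 : component n w = 0.
    by apply: wt; apply: contra nt => nt; apply/mapP; exists n.
  by rewrite /push /c w1 w0 !linear0 addr0.
pose pull n (w : W) : N := a (b (c n.+1 w)) + e (c n w).
have pullL n : linear (pull n).
  by move=> k u v; rewrite /pull !cP !linearP scalerDr addrACA.
have pull_fin (w : W) :
    exists t : seq nat, forall n, n \notin t -> pull n w = 0.
  have [t wt] := component_fin w; exists (t ++ map predn t) => n.
  rewrite mem_cat => /norP[/wt w0 nt].
  have w1 : component n.+1 w = 0.
    by apply: wt; apply: contra nt => nt; apply/mapP; exists n.+1.
  by rewrite /pull /c w1 w0 !linear0 addr0.
pose iM : {linear M -> W} := dirsum_in (fun=> N) 0%N \o a.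
pose rM : {linear W -> M} := b \o @component R nat (fun=> N) 0%N.
pose s : {linear W -> W} := dirsum_tuple (F := fun=> N) pushL push_fin.
pose q : {linear W -> W} := dirsum_tuple (F := fun=> N) pullL pull_fin.
have cs n w : c n (s w) = push n w by [].
have cq n w : c n (q w) = pull n w by [].
exists iM, rM, s, q; split=> [m|w|w].
- by rewrite /rM /iM /= component_in ab.
- apply: dirsumP => n; rewrite -/(c n _) -/(c n w) cq /pull !cs /push.
  rewrite !linearD !be linear0 addr0 ab ee.
  by case: n => [|n]; rewrite ?linear0 ?ea ?add0r abe.
- apply: dirsumP => n; rewrite linearD /= -/(c n _) -/(c n w) cs /push cq /pull.
  rewrite linearD /= ea ee add0r.
  case: n => [|n].
    by rewrite component_in add0r addrC abe.
  by rewrite component_in_ne // addr0 cq /pull linearD /= be addr0 ab abe.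
Qed.

(** With 0 -> M -> W -> W -> 0 split by the swindle: the kernel L of F -> W -> M
    maps onto the complementary copy of W with kernel W1, and the cokernel H
    of M -> W -> F' contains the cokernel W of M -> W with quotient W2.

    For the injectivity of A (x) L -> A (x) F, an element t of the kernel
    becomes zero in A (x) W, because L -> W factors through F.  By right
    exactness t comes from A (x) W1, which injects into A (x) F.  The
    injectivity of A (x) M -> A (x) F' holds since M -> W is split. *)
Lemma retract_syzygies :
  closed_under_extensions (@gorenstein_ac_flat R) ->
  forall M N : lmodType R, gorenstein_ac_flat N -> retract M N ->
  (exists2 L, gorenstein_ac_flat L & syzygy M L) /\
  (exists2 H, gorenstein_ac_flat H & syzygy H M).
Proof.
move=> ext M N gN MN.
have [i [r [s [q [ir sq siq]]]]] := eilenberg_swindle MN.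
have gW := gorenstein_copower gN.
set W := dirsum _ in i r s q ir sq siq gW.
have rs w : r (s w) = 0.
  have := siq (s w); rewrite sq => /(canRL (addKr _)); rewrite addNr.
  by move=> /(congr1 r); rewrite ir linear0.
have qi m : q (i m) = 0.
  have := siq (i m); rewrite ir => /(canRL (addrK _)); rewrite subrr.
  by move=> /(congr1 q); rewrite sq linear0.
split.
  have [W1 gW1 [F [j [p [fF j_inj ex p_surj j_ac]]]]] := gorenstein_syzygy gW.
  (* The syzygy L, as an extension of W by W1. *)
  have [L [l [l_inj lr]]] := kernel_exists (r \o p).
  have [j' lj'] : exists j' : {linear W1 -> L}, forall x, l (j' x) = j x.
    apply: factor_through_inj => // x; apply/lr => /=.
    by rewrite (_ : p _ = 0) ?linear0 //; apply/ex; exists x.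
  pose qL := q \o p \o l.
  have qL_surj : surjective qL.
    move=> w; have [x xw] := p_surj (s w).
    have /lr[y yx] : (r \o p) x = 0 by rewrite /= xw rs.
    by exists y; rewrite /qL /= yx xw sq.
  have ex' : exact j' qL.
    move=> y; split=> [qy|[x <-]]; last first.
      rewrite /qL /= lj' (_ : p _ = 0) ?linear0 //.
      by apply/ex; exists x.
    have ry : r (p (l y)) = 0 by apply/lr; exists y.
    have /ex[x xy] : p (l y) = 0.
      by rewrite -(siq (p (l y))) ry linear0 [q _]qy linear0 addr0.
    by exists x; apply: l_inj; rewrite lj'.
  have j'_inj : injective j'.
    by move=> x y xy; apply: j_inj; rewrite -!lj' xy.
  exists L; first exact: ext j'_inj ex' qL_surj gW1 gW.
  exists F, l, (r \o p); split=> //.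
    move=> m; have [x xm] := p_surj (i m).
    by exists x; rewrite /= xm ir.
  move=> A acA t lt.
  have /(tensor_map_exact (A := A) ex' qL_surj)[u ut] :
      tensor_map (@idfun A) qL t = 0.
    rewrite -[LHS](tensor_map_comp idfun idfun l (q \o p)) lt.
    by rewrite raddf0.
  rewrite -ut (j_ac _ acA u) ?raddf0 // -lt -ut tensor_map_comp.
  by apply: eq_tensor_map => // x; rewrite /= lj'.
have [W2 gW2 [F [j [p [fF j_inj ex p_surj j_ac]]]]] := gorenstein_cosyzygy gW.
have pj w : p (j w) = 0 by apply/ex; exists w.
(* The cokernel H, as an extension of W2 by W. *)
have [H [h [h_surj exH]]] := cokernel_exists (j \o i).
have [p' p'h] : exists p' : {linear H -> W2}, forall x, p' (h x) = p x.
  by apply: factor_through_surj => // x /exH[m <-] /=.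
pose g := h \o j \o s.
exists H.
  apply: (ext W H W2 g p') => //.
  - apply: injective_ker0 => w /exH[m /= jm].
    by rewrite -(sq w) -(j_inj _ _ jm).
  - move=> y; have [x <-] := h_surj y; rewrite p'h; split.
      move=> /ex[w <-]; exists (q w); rewrite /g /=.
      apply/subr0_eq; rewrite -linearB -linearB; apply/exH.
      exists (- r w) => /=; congr (j _).
      by rewrite -[X in _ - X](siq w) opprD addrA subrr sub0r linearN.
    by move=> [w gw]; rewrite -p'h -gw p'h.
  - by move=> z; have [x <-] := p_surj z; exists (h x).
exists F, (j \o i), h; split=> //.
  by apply: inj_comp j_inj _; exact: can_inj ir.
move=> A acA t; rewrite -[X in X = _](tensor_map_comp idfun idfun i j).
by move=> /(j_ac _ acA); exact: tensor_retract_inj ir.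
Qed.

(** The class of retracts of Gorenstein AC-flat modules contains the Gorenstein
    AC-flat modules, hence the syzygies just found for each of its members. *)
Lemma gorenstein_retract :
  closed_under_extensions (@gorenstein_ac_flat R) ->
  forall M N : lmodType R,
    gorenstein_ac_flat N -> retract M N -> gorenstein_ac_flat M.
Proof.
move=> ext M N gN MN.
pose C (M : lmodType R) :=
  exists2 N : lmodType R, gorenstein_ac_flat N & retract M N.
have GC L : gorenstein_ac_flat L -> C L.
  by move=> gL; exists L => //; exact: retract_refl.
have [|||Z [<- Zs]] := @chain_of_class R C _ _ M.
- move=> M' [N' gN' MN'].
  by have [[L /GC CL ML] _] := retract_syzygies ext gN' MN'; exists L.
- move=> M' [N' gN' MN'].
  by have [_ [H /GC CH HM]] := retract_syzygies ext gN' MN'; exists H.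
- by exists N.
exact: gorenstein_of_chain.
Qed.
End Swindle.

Theorem theorem4p9 (R : pzRingType) :
  (forall M : lmodType R, gorenstein_ac_flat M ->
     exists S : lmodType R,
       strongly_gorenstein_ac_flat S /\ direct_summand M S) /\
  (closed_under_extensions (@gorenstein_ac_flat R) ->
     forall M N : lmodType R,
       gorenstein_ac_flat N -> direct_summand M N -> gorenstein_ac_flat M).
Proof.
split; first exact: gorenstein_summand_strongly.
by move=> ext M N gN /direct_summandP; exact: gorenstein_retract.
Qed.
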